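(* Let $X_1,\dots,X_m\subseteq\mathbb{R}^n$ be nonempty closed convex sets with intersection $X=\bigcap_{i=1}^m X_i$, and suppose the Interior Point assumption holds: there are a vector $\bar x\in\mathbb{R}^n$ and a scalar $\delta>0$ with $\{z\mid\|z-\bar x\|\le\delta\}\subset X$. Suppose also that the Weights Rule, Doubly Stochasticity, Connectivity and Bounded Intercommunication Interval assumptions (stated in the context) hold, and that the weight vectors are $a^i(k)=(1/m,\dots,1/m)'$ for all $i$ and $k$. For all $i$, let $\{x^i(k)\}$ be generated by $$x^i(k+1)=P_{X_i}\Big[\sum_{j=1}^m a^i_j(k)x^j(k)\Big],\qquad k\ge0,\quad x^i(0)\in X_i.$$ Then $$\sum_{i=1}^m\|x^i(k)-\tilde x\|^2\le\Big(1-\frac{1}{4R^2}\Big)^k\sum_{i=1}^m\|x^i(0)-\tilde x\|^2\qquad\text{for all } k\ge0,$$ where $\tilde x\in X$ is the limit of the sequence $\{x^i(k)\}$ (this limit exists and is the same for all $i$), and $R=\frac1\delta\sum_{i=1}^m\|x^i(0)-\bar x\|$.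
   Context: $\|\cdot\|$ is the Euclidean norm and $P_C[z]$ is the Euclidean projection of $z$ on a closed convex set $C$. The weights are real numbers $a^i_j(k)$, $i,j\in\{1,\dots,m\}$, $k\ge0$, with $a^i(k)=(a^i_1(k),\dots,a^i_m(k))'$. Assumptions: Weights Rule: there is a scalar $\eta$ with $0<\eta<1$ such that for all $i$: (a) $a^i_i(k)\ge\eta$ for all $k\ge0$; (b) if $a^i_j(k)>0$ then $a^i_j(k)\ge\eta$. Doubly Stochasticity: (a) $a^i(k)\ge0$ and $\sum_{j=1}^m a^i_j(k)=1$ for all $i,k$; (b) $\sum_{i=1}^m a^i_j(k)=1$ for all $j,k$. Connectivity: let $V=\{1,\dots,m\}$, $E_k=\{(j,i)\mid a^i_j(k)>0\}$, and $E_\infty=\{(j,i)\mid (j,i)\in E_k \text{ for infinitely many } k\}$. The directed graph $(V,E_\infty)$ is strongly connected. Bounded Intercommunication Interval: there is an integer $B\ge1$ such that for every $(j,i)\in E_\infty$ and every $k\ge0$, $(j,i)\in E_k\cup E_{k+1}\cup\dots\cup E_{k+B-1}$.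
   Formalization: The factor 1−1/(4R²) is replaced by max(0, 1−1/(4R²)), since for 0<R<1/2 it is negative and the stated bound fails at odd k; for R=0, where 1/(4R²) is undefined, the factor is taken to be 1. *)

(* Defs.v *)
From mathcomp Require Import all_boot all_order all_algebra.
From mathcomp Require Import all_classical all_reals all_analysis.

Set Implicit Arguments.
Unset Strict Implicit.
Unset Printing Implicit Defensive.

Import Order.TTheory GRing.Theory Num.Theory.
Import numFieldNormedType.Exports.

Local Open Scope classical_set_scope.
Local Open Scope ring_scope.

(* The library norm [`|x|] on ['rV[R]_n] is the max norm. It induces the same
   topology as [enorm], so [closed] and [-->] can be taken from the library. *)
Definition enorm (R : realType) (n : nat) (x : 'rV[R]_n) : R :=
  Num.sqrt (\sum_j x 0 j ^+ 2).

Definition is_proj (R : realType) (n : nat) (C : set 'rV[R]_n)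
    (z p : 'rV[R]_n) : Prop :=
  C p /\ forall y, C y -> enorm (z - p) <= enorm (z - y).

(* For [C] nonempty, closed and convex, [is_proj C z] holds of exactly one
   point, and [get] returns it. *)
Definition projection (R : realType) (n : nat) (C : set 'rV[R]_n) (z : 'rV[R]_n) :
  'rV[R]_n := get [set p | is_proj C z p].

(* The weight $a^i_j(k)$ is [a i k 0 j]. *)
Definition weights (R : realType) (m : nat) : Type := 'I_m -> nat -> 'rV[R]_m.

Definition weights_rule (R : realType) (m : nat) (a : weights R m) : Prop :=
  exists eta : R, [/\ 0 < eta < 1,
    forall i k, eta <= a i k 0 i &
    forall i j k, 0 < a i k 0 j -> eta <= a i k 0 j].

Definition doubly_stochastic (R : realType) (m : nat) (a : weights R m) : Prop :=
  [/\ forall i j k, 0 <= a i k 0 j,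
      forall i k, \sum_j a i k 0 j = 1 &
      forall j k, \sum_i a i k 0 j = 1].

(* The edge goes from the sender [j] to the receiver [i]. *)
Definition edge (R : realType) (m : nat) (a : weights R m) (k : nat) :
  rel 'I_m := fun j i => 0 < a i k 0 j.

Definition edge_inf (R : realType) (m : nat) (a : weights R m) : rel 'I_m :=
  fun j i => `[< infinite_set [set k | edge a k j i] >].

Definition connectivity (R : realType) (m : nat) (a : weights R m) : Prop :=
  forall i j : 'I_m, connect (edge_inf a) i j.

Definition bounded_intercommunication (R : realType) (m : nat)
    (a : weights R m) : Prop :=
  exists2 B : nat, (1 <= B)%N &
    forall i j : 'I_m, edge_inf a j i ->
      forall k, exists2 t, (t < B)%N & edge a (k + t) j i.

(* The constant $R$ of the rate $1 - 1/(4R^2)$. *)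
Definition radius_ratio (R : realType) (n m : nat) (delta : R)
    (xbar : 'rV[R]_n) (x0 : 'I_m -> 'rV[R]_n) : R :=
  delta^-1 * \sum_i enorm (x0 i - xbar).

(* The rate $1 - 1/(4r^2)$, cut off at 0. It is negative exactly when
   $0 < r < 1/2$; then the iterates reach their common limit after one step,
   but an odd power of $1 - 1/(4r^2)$ is no upper bound for a sum of squares:
   for $m = 2$, $X_1 = X_2 = \mathbb{R}$, $\bar x = 0$, $\delta = 100$,
   $x^1(0) = 1$, $x^2(0) = -1$, one gets $r = 1/50$ and
   $0 \le (1 - 625) \cdot 2$ at $k = 1$.
   If $r = 0$ all the iterates equal $\bar x$ and the rate is immaterial
   (here it is 1, by $0^{-1} = 0$). *)
Definition rate (R : realType) (r : R) : R :=
  Num.max 0 (1 - 1 / (4 * r ^+ 2)).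

(* Main.v *)
(* All weights being 1/m, every agent projects the same mean y(k) on its set.
   Projection on X_i gives |x^i(k+1) - w|^2 + d_i(k)^2 <= |y(k) - w|^2 for w in
   the intersection X, where d_i(k) = |y(k) - x^i(k+1)|.  Hence |y(k) - w|
   decreases, and the average q(k) of the d_i(k)^2 is summable.  A convex
   combination of y(k) and xbar lies in X at distance at most r q(k)^(1/2)
   from y(k), with r the constant R of the rate; since y is Fejer monotone with
   respect to X, it converges, within 2 r q(k)^(1/2) of y(k).  The decrease
   m q(k) is therefore at least a fraction 1/(4 r^2) of m |y(k) - xtilde|^2. *)
Require Import Defs.
From mathcomp Require Import all_boot all_order all_algebra.
From mathcomp Require Import all_classical all_reals all_analysis.
From mathcomp Require Import ring lra.

Set Implicit Arguments.
Unset Strict Implicit.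
Unset Printing Implicit Defensive.

Import Order.TTheory GRing.Theory Num.Theory.
Import numFieldNormedType.Exports.

Local Open Scope classical_set_scope.
Local Open Scope ring_scope.

(** * Sums of squares and the Euclidean norm *)

Lemma cauchy_schwarz_sum (R : realFieldType) (I : finType) (u v : I -> R) :
  (\sum_i u i * v i) ^+ 2 <= (\sum_i u i ^+ 2) * (\sum_i v i ^+ 2).
Proof.
set d := \sum_i u i * v i; set A := \sum_i u i ^+ 2; set B := \sum_i v i ^+ 2.
have B_ge0 : 0 <= B by apply: sumr_ge0 => i _; exact: sqr_ge0.
have [B0|B_neq0] := eqVneq B 0.
  have v0 i : v i = 0.
    apply/eqP; rewrite -sqrf_eq0; move/eqP: B0.
    by rewrite psumr_eq0 => [/allP/(_ i)|j _]; [apply; rewrite mem_index_enum|exact: sqr_ge0].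
  by rewrite B0 mulr0 /d big1 ?expr0n// => i _; rewrite v0 mulr0.
(* Expanding the squares of [B * u i - d * v i] and summing gives exactly this product, and [B] can
   then be cancelled. *)
have : 0 <= B * (A * B - d ^+ 2).
  rewrite (_ : _ * _ = \sum_i (B * u i - d * v i) ^+ 2).
    by apply: sumr_ge0 => i _; exact: sqr_ge0.
  rewrite [RHS](eq_bigr (fun i => B ^+ 2 * u i ^+ 2 +
    (d ^+ 2 * v i ^+ 2 - 2 * B * d * (u i * v i)))) => [|i _]; last by ring.
  by rewrite !big_split/= sumrN -!mulr_sumr -/A -/B -/d; ring.
by rewrite pmulr_rge0 ?subr_ge0// lt_neqAle eq_sym B_neq0.
Qed.

Lemma sqr_sum_le (R : realFieldType) (m : nat) (d : 'I_m -> R) :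
  (\sum_i d i) ^+ 2 <= m%:R * \sum_i d i ^+ 2.
Proof.
have := cauchy_schwarz_sum d (fun=> 1).
under eq_bigr do rewrite mulr1.
by rewrite expr1n sumr_const card_ord mulrC.
Qed.

Lemma enorm_ge0 (R : realType) (n : nat) (u : 'rV[R]_n) : 0 <= enorm u.
Proof. exact: sqrtr_ge0. Qed.

Lemma sqr_enorm (R : realType) (n : nat) (u : 'rV[R]_n) :
  enorm u ^+ 2 = \sum_j u 0 j ^+ 2.
Proof. by rewrite sqr_sqrtr//; apply: sumr_ge0 => j _; exact: sqr_ge0. Qed.

Lemma enorm0 (R : realType) (n : nat) : enorm (0 : 'rV[R]_n) = 0.
Proof. by rewrite /enorm big1 ?sqrtr0// => j _; rewrite mxE expr0n. Qed.

Lemma enorm_eq0 (R : realType) (n : nat) (u : 'rV[R]_n) :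
  enorm u = 0 -> u = 0.
Proof.
move=> u0; have /eqP := sqr_enorm u; rewrite u0 expr0n/= eq_sym.
rewrite psumr_eq0 => [/allP u_eq0|j _]; last exact: sqr_ge0.
apply/rowP => j; rewrite mxE; apply/eqP; rewrite -sqrf_eq0.
by apply: u_eq0; rewrite mem_index_enum.
Qed.

Lemma enormZ (R : realType) (n : nat) (c : R) (u : 'rV[R]_n) :
  enorm (c *: u) = `|c| * enorm u.
Proof.
rewrite /enorm; under eq_bigr do rewrite mxE exprMn.
by rewrite -mulr_sumr sqrtrM ?sqr_ge0// sqrtr_sqr.
Qed.

Lemma enormB (R : realType) (n : nat) (u v : 'rV[R]_n) :
  enorm (u - v) = enorm (v - u).
Proof. by rewrite -opprB -scaleN1r enormZ normrN1 mul1r. Qed.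

Lemma sqr_enormD (R : realType) (n : nat) (u v : 'rV[R]_n) :
  enorm (u + v) ^+ 2 =
  enorm u ^+ 2 + 2 * (\sum_j u 0 j * v 0 j) + enorm v ^+ 2.
Proof.
rewrite !sqr_enorm mulr_sumr -!big_split/=.
by apply: eq_bigr => j _; rewrite mxE; ring.
Qed.

Lemma ler_enormD (R : realType) (n : nat) (u v : 'rV[R]_n) :
  enorm (u + v) <= enorm u + enorm v.
Proof.
have uv_ge0 : 0 <= enorm u * enorm v by rewrite mulr_ge0 ?enorm_ge0.
have : \sum_j u 0 j * v 0 j <= enorm u * enorm v.
  rewrite (le_trans (ler_norm _))// -(@ler_pXn2r _ 2)// ?nnegrE ?normr_ge0//.
  by rewrite real_normK ?num_real// exprMn !sqr_enorm cauchy_schwarz_sum.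
move=> h; rewrite -(@ler_pXn2r _ 2)// ?nnegrE ?addr_ge0 ?enorm_ge0//.
rewrite sqr_enormD.
by lra.
Qed.

Lemma sqr_enormD_le (R : realType) (n : nat) (u v : 'rV[R]_n) :
  enorm (u + v) ^+ 2 <= 2 * (enorm u ^+ 2 + enorm v ^+ 2).
Proof.
rewrite !sqr_enorm -big_split mulr_sumr; apply: ler_sum => j _ /=.
by rewrite mxE; have := sqr_ge0 (u 0 j - v 0 j); lra.
Qed.

(** Carries Euclidean estimates over to the max norm, in which boundedness and convergence are
    expressed. *)
Lemma normr_le_enorm (R : realType) (n : nat) (u : 'rV[R]_n) :
  `|u| <= enorm u.
Proof.
rewrite [leLHS]/Num.Def.normr/= mx_normrE.
apply: bigmax_le => [|[i j] _]; first exact: enorm_ge0.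
rewrite -(@ler_pXn2r _ 2)// ?nnegrE ?enorm_ge0// sqr_enorm real_normK ?num_real//.
by rewrite (bigD1 j)//= ord1 lerDl sumr_ge0// => k _; exact: sqr_ge0.
Qed.

Lemma enorm_dist_continuous (R : realType) (n : nat) (z : 'rV[R]_n) :
  continuous (fun u : 'rV[R]_n => enorm (z - u)).
Proof.
rewrite (_ : (fun _ => _) = Num.sqrt \o (fun u => \sum_j (z - u) 0 j ^+ 2))//.
move=> u; apply: continuous_comp; last exact: sqrt_continuous.
move: u; apply: continuous_big => [|j _]; first exact: add_continuous.
have coordB : continuous (fun u : 'rV[R]_n => (z - u) 0 j).
  rewrite (_ : (fun _ => _) = fun u : 'rV[R]_n => z 0 j - u 0 j).
    by move=> u; exact: (cvgB (cvg_cst _) (@coord_continuous _ _ _ _ _ u)).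
  by apply/funext => u; rewrite !mxE.
by move=> u; exact: (cvgM (coordB u) (coordB u)).
Qed.

Lemma closed_enorm_ball (R : realType) (n : nat) (z : 'rV[R]_n) (r : R) :
  closed [set u | enorm (z - u) <= r].
Proof.
rewrite (_ : [set u | _] =
  (fun u : 'rV[R]_n => enorm (z - u)) @^-1` [set t | t <= r])//.
apply: preimage_closed; last exact: closed_le.
by move=> u _; exact: enorm_dist_continuous.
Qed.

Lemma cvg_sqr_enorm (R : realType) (n : nat) (u : nat -> 'rV[R]_n)
    (l : 'rV[R]_n) (e : nat -> R) :
  (forall k, enorm (u k - l) ^+ 2 <= e k) -> e k @[k --> \oo] --> (0 : R) ->
  u k @[k --> \oo] --> l.
Proof.
move=> ule e0; apply/cvgrPdist_lt => eps eps_gt0.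
have /cvgrPdist_lt/(_ (eps ^+ 2)) := e0.
rewrite exprn_gt0// => /(_ isT); apply: filterS => k; rewrite sub0r normrN => ek.
rewrite distrC (le_lt_trans (normr_le_enorm _))//.
rewrite -(@ltr_pXn2r _ 2)// ?nnegrE ?enorm_ge0// ?(ltW eps_gt0)//.
by rewrite (le_lt_trans (ule k))// (le_lt_trans (ler_norm _)).
Qed.

Lemma enorm_mean_le (R : realType) (m n : nat) (m_gt0 : (0 < m)%N)
    (u : 'I_m -> 'rV[R]_n) (z : 'rV[R]_n) :
  m%:R * enorm (m%:R^-1 *: \sum_i u i - z) <= \sum_i enorm (u i - z).
Proof.
have m_neq0 : m%:R != 0 :> R by rewrite pnatr_eq0 -lt0n.
rewrite (_ : _ - z = m%:R^-1 *: \sum_i (u i - z)); last first.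
  rewrite big_split/= sumr_const card_ord scalerDr mulNrn scalerN; congr (_ - _).
  by rewrite -[z *+ m]scaler_nat scalerA mulVf ?scale1r.
rewrite enormZ ger0_norm ?invr_ge0 ?ler0n// mulVKf//.
elim/big_ind2 : _ => [|x1 a1 x2 a2 h1 h2|//]; first by rewrite enorm0.
by rewrite (le_trans (ler_enormD _ _))// lerD.
Qed.

Lemma sqr_enorm_mean_le (R : realType) (m n : nat) (m_gt0 : (0 < m)%N)
    (u : 'I_m -> 'rV[R]_n) (z : 'rV[R]_n) :
  m%:R * enorm (m%:R^-1 *: \sum_i u i - z) ^+ 2 <=
  \sum_i enorm (u i - z) ^+ 2.
Proof.
have m_gt0' : 0 < m%:R :> R by rewrite ltr0n.
rewrite -(ler_pM2l m_gt0') mulrA -expr2 -exprMn.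
apply: le_trans (sqr_sum_le _).
rewrite ler_pXn2r// ?nnegrE ?mulr_ge0 ?ler0n ?enorm_ge0//.
  exact: enorm_mean_le.
by apply: sumr_ge0 => i _; exact: enorm_ge0.
Qed.

(** * Projection on closed convex sets *)

Lemma convex_setP (R : realType) (n : nat) (C : set 'rV[R]_n)
    (u v : 'rV[R]_n) (t : R) :
  convex_set C -> C u -> C v -> 0 <= t -> t <= 1 ->
  C (t *: u + (1 - t) *: v).
Proof.
move=> convC Cu Cv t_ge0 t_le1; apply/set_mem.
by apply: (convC u v (Itv01 t_ge0 t_le1)); exact: mem_set.
Qed.

(** Only points of [C] at least as close to [z] as some fixed [c] in [C] compete for the minimum;
    they form a compact set, on which the continuous distance attains it. *)
Lemma projection_exists (R : realType) (n : nat) (C : set 'rV[R]_n)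
    (z : 'rV[R]_n) :
  C !=set0 -> closed C -> exists p, is_proj C z p.
Proof.
move=> [c Cc] clC; pose D := C `&` [set u | enorm (z - u) <= enorm (z - c)].
have clD : closed D := closedI clC (@closed_enorm_ball _ _ z (enorm (z - c))).
have cD : compact D.
  apply: (bounded_closed_compact _ clD).
  exists (`|z| + enorm (z - c)); split; first exact: num_real.
  move=> M /ltW leM u [_ /= uz]; rewrite (le_trans _ leM)//.
  rewrite -[u](subKr z) (le_trans (ler_normB _ _))// lerD2l.
  exact: le_trans (normr_le_enorm _) uz.
have [p /set_mem[Cp _] pmin] := compact_EVT_min
  (ex_intro D c (conj Cc (lexx _))) cD
  (continuous_subspaceT (@enorm_dist_continuous R n z)).
exists p; split => // y Cy; have [yc|cy] := leP (enorm (z - y)) (enorm (z - c)).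
  by apply: pmin; apply: mem_set; split.
by rewrite (le_trans _ (ltW cy))// pmin//; apply: mem_set; split => /=.
Qed.

Lemma projectionP (R : realType) (n : nat) (C : set 'rV[R]_n) (z : 'rV[R]_n) :
  C !=set0 -> closed C -> is_proj C z (projection C z).
Proof. by move=> C0 clC; have [p] := projection_exists z C0 clC; exact: getI. Qed.

(** Moving from [p] a fraction [t] of the way to [w] stays in [C], so minimality bounds the inner
    product [c] of [z - p] and [p - w] from below; small [t] forces [c >= 0], and expanding the
    square of [(z - p) + (p - w)] concludes. *)
Lemma is_proj_sqr_le (R : realType) (n : nat) (C : set 'rV[R]_n)
    (z p w : 'rV[R]_n) :
  convex_set C -> is_proj C z p -> C w ->
  enorm (p - w) ^+ 2 + enorm (z - p) ^+ 2 <= enorm (z - w) ^+ 2.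
Proof.
move=> convC [Cp pmin] Cw.
pose c := \sum_j (z - p) 0 j * (p - w) 0 j; pose N := enorm (p - w) ^+ 2.
have N_ge0 : 0 <= N by exact: sqr_ge0.
have c_ge0 t : 0 < t -> t <= 1 -> 0 <= 2 * c + t * N.
  move=> t_gt0 t_le1.
  have /pmin := convex_setP convC Cw Cp (ltW t_gt0) t_le1.
  rewrite -(@ler_pXn2r _ 2)// ?nnegrE ?enorm_ge0//.
  rewrite (_ : z - (_ + _) = (z - p) + t *: (p - w)); last first.
    by apply/rowP => j; rewrite !mxE; ring.
  rewrite [leRHS]sqr_enormD enormZ exprMn real_normK ?num_real//.
  rewrite [X in 2 * X](_ : _ = t * c) -/N => [h|]; last first.
    by rewrite mulr_sumr; apply: eq_bigr => j _; rewrite !mxE; ring.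
  by rewrite -(pmulr_rge0 _ t_gt0); lra.
rewrite (_ : z - w = (z - p) + (p - w)); last by rewrite addrA subrK.
rewrite [leRHS]sqr_enormD -/c -/N.
suff : 0 <= c by lra.
rewrite leNgt; apply/negP => c_lt0.
have d_gt0 : 0 < N - c by lra.
(* An explicit small [t] replaces the limit at 0: it lies in ]0, 1] and satisfies [t * N <= - c], so
   [2 * c + t * N <= c < 0]. *)
have := c_ge0 (- c / (N - c)); rewrite divr_gt0 ?oppr_gt0// ler_pdivrMr// mul1r.
rewrite lerDr => /(_ isT N_ge0); rewrite leNgt => /negP; apply.
have : - c / (N - c) * N <= - c.
  by rewrite mulrAC ler_pdivrMr// ler_wpM2l ?oppr_ge0 ?(ltW c_lt0)//; lra.
by lra.
Qed.

(** * Distance to the intersection and Fejer monotone sequences *)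

(** The interior ball turns closeness to each set separately into closeness to the intersection:
    pulling [y] slightly towards [xbar] puts it in all the sets at once. *)
Lemma interior_shrink (R : realType) (m n : nat) (X : 'I_m -> set 'rV[R]_n)
    (xbar y : 'rV[R]_n) (delta : R) (p : 'I_m -> 'rV[R]_n) :
  (forall i, convex_set (X i)) -> 0 < delta ->
  [set z | enorm (z - xbar) <= delta] `<=` \bigcap_i X i ->
  (forall i, X i (p i)) ->
  exists2 s, (\bigcap_i X i) s &
    delta * enorm (y - s) <= (\sum_i enorm (y - p i)) * enorm (y - xbar).
Proof.
move=> convX delta_gt0 ballX Xp; set eps := \sum_i _.
have le_eps i : enorm (y - p i) <= eps.
  by rewrite /eps (bigD1 i)//= lerDl sumr_ge0// => j _; exact: enorm_ge0.
have eps_ge0 : 0 <= eps by apply: sumr_ge0 => i _; exact: enorm_ge0.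
have [eps0|eps_neq0] := eqVneq eps 0.
  exists y; last by rewrite subrr enorm0 mulr0 mulr_ge0 ?enorm_ge0.
  move=> i _; suff -> : y = p i by exact: Xp.
  apply/eqP; rewrite -subr_eq0; apply/eqP/enorm_eq0/le_anti.
  by rewrite enorm_ge0 -eps0 le_eps.
have eps_gt0 : 0 < eps by rewrite lt_neqAle eq_sym eps_neq0.
have ed_gt0 : 0 < eps + delta by rewrite addr_gt0.
have ed_neq0 : eps + delta != 0 by rewrite gt_eqF.
(* This [t] solves [t * (delta / eps) = 1 - t], which makes the two convex combinations below
   agree. *)
pose t := eps / (eps + delta).
have t_ge0 : 0 <= t by rewrite divr_ge0// ltW.
exists (t *: xbar + (1 - t) *: y).
  (* The point is also a convex combination of [p i] and of a point [z] of the
     ball, for every [i]. *)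
  move=> i _; pose z := xbar + (delta / eps) *: (y - p i).
  rewrite (_ : _ + _ = t *: z + (1 - t) *: p i); last first.
    by apply/rowP => j; rewrite !mxE /t; field; rewrite ed_neq0 eps_neq0.
  apply: convex_setP => //; last by rewrite /t ler_pdivrMr// mul1r lerDl ltW.
  apply: ballX => //=; rewrite /z addrAC subrr add0r enormZ.
  rewrite ger0_norm ?divr_ge0// ?(ltW delta_gt0)// mulrAC ler_pdivrMr//.
  by rewrite ler_wpM2l// ltW.
rewrite (_ : y - _ = t *: (y - xbar)); last first.
  by apply/rowP => j; rewrite !mxE; ring.
rewrite enormZ ger0_norm// mulrA ler_wpM2r ?enorm_ge0//.
by rewrite /t mulrA ler_pdivrMr// mulrDr [leLHS]mulrC lerDr mulr_ge0.
Qed.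

(** Since [s k] is in [C], all iterates from [k] on stay within [Num.sqrt (q k)] of it. These balls
    shrink, so [y] is Cauchy, and its limit lies in each of them. The factor 4 comes from going from
    [y k] to the limit through [s k]. *)
Lemma fejer_limit (R : realType) (n : nat) (C : set 'rV[R]_n)
    (y : nat -> 'rV[R]_n) (q : nat -> R) :
  closed C ->
  (forall w k, C w -> enorm (y k.+1 - w) ^+ 2 <= enorm (y k - w) ^+ 2) ->
  (forall k, exists s, C s /\ enorm (y k - s) ^+ 2 <= q k) ->
  q k @[k --> \oo] --> (0 : R) ->
  exists2 l, C l & forall k, enorm (y k - l) ^+ 2 <= 4 * q k.
Proof.
move=> clC fejer /choice[s sP] q0.
have Cs k := (sP k).1; have ys_le k := (sP k).2.
have yls_le k l : (k <= l)%N -> enorm (y l - s k) ^+ 2 <= q k.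
  elim: l => [|l IHl]; first by rewrite leqn0 => /eqP ->.
  rewrite leq_eqVlt => /predU1P[<-//|kl].
  exact: le_trans (fejer _ _ (Cs k)) (IHl kl).
have cauchy_y : cauchy (y @ \oo).
  apply: cauchy_exP => e e_gt0.
  have /cvgrPdist_lt/(_ (e ^+ 2)) := q0.
  rewrite exprn_gt0// => /(_ isT)[N _ /(_ N (leqnn N))].
  rewrite /= sub0r normrN => qN_lt.
  exists (s N); exists N => // l /= Nl; rewrite -ball_normE/=.
  rewrite distrC (le_lt_trans (normr_le_enorm _))//.
  rewrite -(@ltr_pXn2r _ 2)// ?nnegrE ?enorm_ge0// ?(ltW e_gt0)//.
  by rewrite (le_lt_trans (yls_le _ _ Nl))// (le_lt_trans (ler_norm _)).
have yl : y k @[k --> \oo] --> lim (y @ \oo) by exact: cauchy_cvg cauchy_y.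
set l := lim _ in yl.
have ls_le k : enorm (s k - l) ^+ 2 <= q k.
  have q_ge0 : 0 <= q k by apply: le_trans (ys_le k); exact: sqr_ge0.
  have sq_le w : (enorm (s k - w) <= Num.sqrt (q k)) = (enorm (w - s k) ^+ 2 <= q k).
    rewrite -[in RHS](sqr_sqrtr q_ge0) enormB.
    by rewrite ler_pXn2r// ?nnegrE ?enorm_ge0 ?sqrtr_ge0.
  rewrite enormB -sq_le.
  apply: (closed_cvg _ (@closed_enorm_ball _ _ (s k) (Num.sqrt (q k))) _ _ yl).
  by exists k => // j /= kj; rewrite sq_le yls_le.
exists l; last first.
  move=> k; rewrite (_ : y k - l = (y k - s k) + (s k - l)).
    by rewrite (le_trans (sqr_enormD_le _ _))//; have := ys_le k; have := ls_le k; lra.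
  by rewrite addrA subrK.
(* The points [s k] of [C] converge to [l] as well, whereas the [y k] may lie outside [C]. *)
apply: (closed_cvg C clC _ _ (cvg_sqr_enorm ls_le q0)).
by apply: nearW.
Qed.

(** * Convergence of the iterates and the geometric rate *)

Theorem proposition3 (R : realType) (m n : nat) (m_gt0 : (0 < m)%N)
    (X : 'I_m -> set 'rV[R]_n)
    (X_neq0 : forall i, X i !=set0)
    (X_closed : forall i, closed (X i))
    (X_convex : forall i, convex_set (X i))
    (xbar : 'rV[R]_n) (delta : R) (delta_gt0 : 0 < delta)
    (interior_point : [set z | enorm (z - xbar) <= delta] `<=` \bigcap_i X i)
    (a : weights R m)
    (a_rule : weights_rule a)
    (a_stochastic : doubly_stochastic a)
    (a_connected : connectivity a)
    (a_bounded : bounded_intercommunication a)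
    (a_uniform : forall i k, a i k = const_mx (1 / m%:R))
    (x : 'I_m -> nat -> 'rV[R]_n)
    (x_init : forall i, X i (x i 0%N))
    (x_step : forall i k, x i k.+1 = projection (X i) (\sum_j a i k 0 j *: x j k)) :
  exists xtilde : 'rV[R]_n,
    [/\ (\bigcap_i X i) xtilde,
        forall i, x i k @[k --> \oo] --> xtilde &
        forall k : nat,
          \sum_i enorm (x i k - xtilde) ^+ 2 <=
            rate (radius_ratio delta xbar (fun i => x i 0%N)) ^+ k *
            \sum_i enorm (x i 0%N - xtilde) ^+ 2].
Proof.
have m_gt0' : 0 < m%:R :> R by rewrite ltr0n.
have m_neq0 : m%:R != 0 :> R by rewrite gt_eqF.
pose y k := m%:R^-1 *: \sum_j x j k.
pose D i k := enorm (y k - x i k.+1).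
pose q k := m%:R^-1 * \sum_i D i k ^+ 2.
set r := radius_ratio _ _ _.
have r_ge0 : 0 <= r.
  by rewrite mulr_ge0 ?invr_ge0 ?(ltW delta_gt0)// sumr_ge0// => i _; exact: enorm_ge0.
have q_ge0 k : 0 <= q k.
  by rewrite mulr_ge0 ?invr_ge0 ?ler0n// sumr_ge0// => i _; exact: sqr_ge0.
have x_proj i k : is_proj (X i) (y k) (x i k.+1).
  rewrite x_step (_ : \sum_j _ = y k); first exact: projectionP.
  by rewrite /y scaler_sumr; apply: eq_bigr => j _; rewrite a_uniform mxE div1r.
have step_le w i k : (\bigcap_i X i) w ->
    enorm (x i k.+1 - w) ^+ 2 + D i k ^+ 2 <= enorm (y k - w) ^+ 2.
  by move=> Xw; apply: is_proj_sqr_le (X_convex i) (x_proj i k) (Xw i I).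
have sum_step_le w k : (\bigcap_i X i) w ->
    \sum_i enorm (x i k.+1 - w) ^+ 2 + m%:R * q k <= m%:R * enorm (y k - w) ^+ 2.
  move=> Xw; rewrite /q mulVKf// -big_split/=.
  apply: (@le_trans _ _ (\sum_(i < m) enorm (y k - w) ^+ 2)).
    by apply: ler_sum => i _; exact: step_le.
  by rewrite sumr_const card_ord mulr_natl.
have y_step_le w k : (\bigcap_i X i) w ->
    enorm (y k.+1 - w) ^+ 2 + q k <= enorm (y k - w) ^+ 2.
  move=> Xw; rewrite -(ler_pM2l m_gt0') mulrDr.
  apply: le_trans (sum_step_le _ _ Xw); rewrite lerD2r.
  exact: sqr_enorm_mean_le.
have Xxbar : (\bigcap_i X i) xbar.
  by apply: interior_point; rewrite /= subrr enorm0 ltW.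
have y_xbar_le k : m%:R * enorm (y k - xbar) <= delta * r.
  rewrite /r /radius_ratio mulVKf ?gt_eqF//.
  apply: le_trans (enorm_mean_le m_gt0 _ _) _.
  (* The sum of the distances to [xbar] never grows: each projection is no farther from [xbar] than
     the mean, whose distance is at most the average one. *)
  elim: k => // k IHk; apply: le_trans IHk.
  apply: le_trans (enorm_mean_le m_gt0 (x^~ k) xbar).
  apply: (@le_trans _ _ (\sum_(i < m) enorm (y k - xbar))); last first.
    by rewrite sumr_const card_ord mulr_natl.
  apply: ler_sum => i _; rewrite -(@ler_pXn2r _ 2)// ?nnegrE ?enorm_ge0//.
  by apply: le_trans (step_le _ i k Xxbar); rewrite lerDl sqr_ge0.
have y_near k : exists s, (\bigcap_i X i) s /\ enorm (y k - s) ^+ 2 <= r ^+ 2 * q k.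
  have [i|s Xs ds] := interior_shrink (y k) X_convex delta_gt0 interior_point
    (p := fun i => x i k.+1); first by have [] := x_proj i k.
  exists s; split => //; set E := \sum_i _ in ds.
  have E_ge0 : 0 <= E by apply: sumr_ge0 => i _; exact: enorm_ge0.
  (* The bound [delta * r] on [m%:R * enorm (y k - xbar)] cancels [delta]. Squaring and
     Cauchy-Schwarz then give [E ^+ 2 <= m%:R ^+ 2 * q k], so [m] cancels too. *)
  have mys : m%:R * enorm (y k - s) <= r * E.
    have h1 := ler_wpM2l (ltW m_gt0') ds.
    have h2 := ler_wpM2l E_ge0 (y_xbar_le k).
    by rewrite -(ler_pM2l delta_gt0); lra.
  have : (m%:R * enorm (y k - s)) ^+ 2 <= r ^+ 2 * (m%:R * \sum_i D i k ^+ 2).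
    apply: (@le_trans _ _ ((r * E) ^+ 2)).
      by rewrite ler_pXn2r// nnegrE mulr_ge0 ?ler0n ?enorm_ge0.
    by rewrite exprMn ler_wpM2l ?sqr_ge0// sqr_sum_le.
  rewrite (_ : \sum_i D i k ^+ 2 = m%:R * q k); last by rewrite /q mulVKf.
  rewrite exprMn (_ : r ^+ 2 * _ = m%:R ^+ 2 * (r ^+ 2 * q k)); last by ring.
  by rewrite ler_pM2l// exprn_gt0.
have q_cvg0 : q k @[k --> \oo] --> (0 : R).
  (* [q k] is at most the decrement of [e], which tends to 0 because [e] is nonincreasing and
     bounded below. *)
  pose e k := enorm (y k - xbar) ^+ 2.
  have e_noninc : nonincreasing_seq e.
    apply/nonincreasing_seqP => k.
    by apply: le_trans (y_step_le _ k Xxbar); rewrite lerDl.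
  have e_lb : has_lbound (range e) by exists 0 => _ [k _ <-]; exact: sqr_ge0.
  have e_cvg := nonincreasing_is_cvgn e_noninc e_lb.
  have e1_cvg : e k.+1 @[k --> \oo] --> lim (e @ \oo) by rewrite cvg_shiftS.
  apply: (@squeeze_cvgr _ _ _ _ (fun=> 0) (fun k => e k - e k.+1)).
  - apply: nearW => k; rewrite q_ge0/=.
    by have := y_step_le _ k Xxbar; rewrite /e; lra.
  - exact: cvg_cst.
  - by rewrite -(subrr (lim (e @ \oo))); exact: cvgB.
have X_closed_bigcap : closed (\bigcap_i X i).
  by apply: closed_bigI => i _; exact: X_closed.
have [||l Xl yl_le] := fejer_limit X_closed_bigcap _ y_near.
- move=> w k Xw; apply: le_trans (y_step_le _ k Xw).
  by rewrite lerDl.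
- by rewrite -(mulr0 (r ^+ 2)); exact: cvgMr.
have step_l k : \sum_i enorm (x i k.+1 - l) ^+ 2 + m%:R * q k <=
    m%:R * enorm (y k - l) ^+ 2 by exact: sum_step_le.
exists l; split => //.
  (* The shift is needed because it is [x i k.+1] that is no farther from [l] than [y k]. *)
  move=> i; rewrite -cvg_shiftS.
  apply: (@cvg_sqr_enorm _ _ _ _ (fun k => 4 * (r ^+ 2 * q k))).
    move=> k; apply: le_trans (yl_le k).
    by apply: le_trans (step_le _ i k Xl); rewrite lerDl sqr_ge0.
  rewrite -(mulr0 4); apply: cvgMr; rewrite -(mulr0 (r ^+ 2)); exact: cvgMr.
pose V k := \sum_i enorm (x i k - l) ^+ 2.
have V_ge0 k : 0 <= V k by apply: sumr_ge0 => i _; exact: sqr_ge0.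
have yV k : m%:R * enorm (y k - l) ^+ 2 <= V k by exact: sqr_enorm_mean_le.
have V_step k : V k.+1 <= rate r * V k.
  (* For [r = 0] the convention [0^-1 = 0] makes the rate 1, and monotonicity of [V] suffices. *)
  have [r0|r_neq0] := eqVneq r 0.
    rewrite /rate r0 expr0n mulr0 invr0 mulr0 subr0 max_r// mul1r.
    apply: le_trans (yV k); apply: le_trans (step_l k).
    by rewrite lerDl mulr_ge0 ?ler0n.
  have r4_gt0 : 0 < 4 * r ^+ 2 by rewrite mulr_gt0// exprn_even_gt0.
  pose Y := m%:R * enorm (y k - l) ^+ 2.
  have Y_ge0 : 0 <= Y by rewrite mulr_ge0 ?ler0n ?sqr_ge0.
  have Yq : 1 / (4 * r ^+ 2) * Y <= m%:R * q k.
    rewrite mul1r mulrC ler_pdivrMr// /Y -mulrA ler_pM2l//.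
    by rewrite [leRHS]mulrC -mulrA; exact: yl_le.
  apply: (@le_trans _ _ ((1 - 1 / (4 * r ^+ 2)) * Y)).
    by have := step_l k; rewrite mulrBl mul1r -/(V k.+1) -/Y; lra.
  (* The factor may be negative, so it is cut off at 0 before [Y] is replaced by the larger
     [V k]. *)
  apply: (@le_trans _ _ (rate r * Y)); first by rewrite ler_wpM2r// le_max lexx orbT.
  by rewrite ler_wpM2l ?yV// /rate le_max lexx.
elim=> [|k IHk]; first by rewrite expr0 mul1r.
rewrite exprS -mulrA; apply: le_trans (V_step k) _.
by rewrite ler_wpM2l// /rate le_max lexx.
Qed.
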